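(* Let $Z$ be the non-smooth vector field (NSVF) on $\mathbb{R}^2$ given by $$Z(x,y)=\begin{cases}X(x,y)=(1,-2x), & y\ge 0,\\ Y(x,y)=(-2,-4x^3+2x), & y\le 0,\end{cases}$$ considered on its compact invariant set $K=\{(x,y)\in\mathbb{R}^2: -1\le x\le 1,\ \tfrac{x^4}{2}-\tfrac{x^2}{2}\le y\le 1-x^2\}$. Then $Z$ has infinite topological entropy, $h(Z)=\infty$.
   Context: Here $f(x,y)=y$, $\Sigma=\{y=0\}$, $\Sigma^+=\{y>0\}$, $\Sigma^-=\{y<0\}$; $\phi_X,\phi_Y$ are the flows of $X,Y$. Put $Xf(p)=\langle\nabla f(p),X(p)\rangle$, $X^2f(p)=\langle\nabla (Xf)(p),X(p)\rangle$, and similarly for $Y$. Regions of $\Sigma$: $\Sigma^{c+}=\{Xf>0,Yf>0\}$, $\Sigma^{c-}=\{Xf<0,Yf<0\}$ (crossing); $\Sigma^{s}=\{Xf<0,Yf>0\}$ (sliding); $\Sigma^{e}=\{Xf>0,Yf<0\}$ (escaping). A tangency point is $p\in\Sigma$ with $Xf(p)\,Yf(p)=0$. A fold of $X$ is a point with $Xf(p)=0\ne X^2f(p)$; it is visible if $X^2f(p)>0$ and invisible if $X^2f(p)<0$; for $Y$ the two inequalities are interchanged. A tangency point is singular if it is an invisible tangency for both $X$ and $Y$, and regular otherwise. The sliding vector field on $\Sigma^s\cup\Sigma^e$ is $Z^s=\dfrac{(Yf)X-(Xf)Y}{Yf-Xf}$, extended to $\overline{\Sigma^s}\cup\overline{\Sigma^e}$.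 Local trajectories through $p$ ($t$ in an interval $I\ni 0$, origin of time at $p$; $\phi_X$, $\phi_Y$, $\phi_{Z^s}$ are followed while they remain in $\overline{\Sigma^+}$, $\overline{\Sigma^-}$, $\overline{\Sigma^s}\cup\overline{\Sigma^e}$ respectively): (i) $\phi_X$ if $p\in\Sigma^+$, $\phi_Y$ if $p\in\Sigma^-$; (ii) if $p\in\Sigma^{c+}$: $\phi_Y$ for $t\le0$ and $\phi_X$ for $t\ge0$; if $p\in\Sigma^{c-}$ the same reversing time; (iii) if $p\in\Sigma^e$: $\phi_{Z^s}$ for $t\le 0$ and any one of $\phi_X,\phi_Y,\phi_{Z^s}$ for $t\ge0$; if $p\in\Sigma^s$ the same reversing time; (iv) if $p$ is a regular tangency: $\phi_1$ for $t\le0$ and $\phi_2$ for $t\ge0$, each of $\phi_1,\phi_2$ being any of $\phi_X,\phi_Y,\phi_{Z^s}$; (v) if $p$ is a singular tangency: constantly $p$ for all $t\in\mathbb{R}$. A global trajectory is a curve $\gamma$ defined on $\mathbb{R}$ that is an orientation-preserving concatenation of local trajectories $\sigma_i$ on $[t_i,t_{i+1}]$, $i\in\mathbb{Z}$, with matching endpoints and $t_i\to\pm\infty$ as $i\to\pm\infty$. Entropy of a map. For a continuous self-map $g$ of a metric space $(W,d)$ let $d_n^g(x,y)=\max_{0\le i\le n-1}d(g^i(x),g^i(y))$, let $S_d(g,\varepsilon,n)$ be the minimal cardinality of a set $E\subset W$ such that the open $d^g_n$-balls of radius $\varepsilon$ centered at points of $E$ cover $W$ (with $\log\infty=\infty$),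 and $h(g)=\lim_{\varepsilon\to0}\limsup_{n\to\infty}\frac1n\log S_d(g,\varepsilon,n)$. Entropy of $Z$. $\Omega$ is the set of all global trajectories of $Z$ contained in $K$, with metric $\rho(\gamma_1,\gamma_2)=\sum_{i\in\mathbb{Z}}2^{-|i|}\int_i^{i+1}|\gamma_1(t)-\gamma_2(t)|\,dt$; $F_1:\Omega\to\Omega$, $F_1(\gamma)(\cdot)=\gamma(\cdot+1)$; and $h(Z):=h(F_1)$. *)

(* Defs.v *)
From HB Require Import structures.
From mathcomp Require Import all_boot all_order all_algebra.
From mathcomp Require Import all_classical all_reals all_analysis.

Set Implicit Arguments.
Unset Strict Implicit.
Unset Printing Implicit Defensive.

Import Order.TTheory GRing.Theory Num.Theory.
Import numFieldNormedType.Exports.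

Local Open Scope classical_set_scope.
Local Open Scope ring_scope.

(* The library norm on R * R is the sup norm, so the Euclidean structure of
   the plane is introduced separately. *)
Definition dotp (R : realType) (u v : R * R) : R := u.1 * v.1 + u.2 * v.2.

Definition enorm (R : realType) (u : R * R) : R := Num.sqrt (dotp u u).

Definition grad (R : realType) (g : R * R -> R) (p : R * R) : R * R :=
  (derive g p (1, 0), derive g p (0, 1)).

Definition lie (R : realType) (V : R * R -> R * R) (g : R * R -> R)
    (p : R * R) : R :=
  dotp (grad g p) (V p).

(* A vector field that is X on {y >= 0} and Y on {y <= 0}; both fields are
   given on the whole plane. *)
Record nsvf (R : realType) := NSVF {
  fieldX : R * R -> R * R;
  fieldY : R * R -> R * R
}.

Definition switch (R : realType) (p : R * R) : R := p.2.

Definition Sigma (R : realType) : set (R * R) := [set p | switch p = 0].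
Definition Sigma_pos (R : realType) : set (R * R) := [set p | 0 < switch p].
Definition Sigma_neg (R : realType) : set (R * R) := [set p | switch p < 0].

Definition Xf (R : realType) (Z : nsvf R) : R * R -> R :=
  lie (fieldX Z) (@switch R).
Definition Yf (R : realType) (Z : nsvf R) : R * R -> R :=
  lie (fieldY Z) (@switch R).
Definition X2f (R : realType) (Z : nsvf R) : R * R -> R :=
  lie (fieldX Z) (Xf Z).
Definition Y2f (R : realType) (Z : nsvf R) : R * R -> R :=
  lie (fieldY Z) (Yf Z).

Definition crossing_pos (R : realType) (Z : nsvf R) : set (R * R) :=
  [set p | [/\ Sigma p, 0 < Xf Z p & 0 < Yf Z p]].
Definition crossing_neg (R : realType) (Z : nsvf R) : set (R * R) :=
  [set p | [/\ Sigma p, Xf Z p < 0 & Yf Z p < 0]].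
Definition sliding (R : realType) (Z : nsvf R) : set (R * R) :=
  [set p | [/\ Sigma p, Xf Z p < 0 & 0 < Yf Z p]].
Definition escaping (R : realType) (Z : nsvf R) : set (R * R) :=
  [set p | [/\ Sigma p, 0 < Xf Z p & Yf Z p < 0]].

Definition tangency (R : realType) (Z : nsvf R) : set (R * R) :=
  [set p | Sigma p /\ Xf Z p * Yf Z p = 0].
Definition invisible_X (R : realType) (Z : nsvf R) : set (R * R) :=
  [set p | Xf Z p = 0 /\ X2f Z p < 0].
Definition invisible_Y (R : realType) (Z : nsvf R) : set (R * R) :=
  [set p | Yf Z p = 0 /\ 0 < Y2f Z p].
Definition singular_tangency (R : realType) (Z : nsvf R) : set (R * R) :=
  tangency Z `&` (invisible_X Z `&` invisible_Y Z).
Definition regular_tangency (R : realType) (Z : nsvf R) : set (R * R) :=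
  tangency Z `\` (invisible_X Z `&` invisible_Y Z).

Definition sliding_formula (R : realType) (Z : nsvf R) (p : R * R) : R * R :=
  (Yf Z p - Xf Z p)^-1 *: (Yf Z p *: fieldX Z p - Xf Z p *: fieldY Z p).

(* The quotient may be of the form 0/0 at the endpoints of a sliding or
   escaping arc; there the field is its continuous extension, that is, the
   limit of the formula along the open arcs. *)
Definition sliding_field (R : realType) (Z : nsvf R) : R * R -> R * R :=
  let D := sliding Z `|` escaping Z in
  patch (fun p => xget (0, 0) [set v : R * R |
                    sliding_formula Z q @[q --> within D (nbhs p)] --> v])
        D (sliding_formula Z).

(* Orbit segments of the flow of V over the time interval J. *)
Definition integral_curve (R : realType) (V : R * R -> R * R) (J : set R)
    (s : R -> R * R) : Prop :=
  {within J, continuous s} /\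
  forall t, interior J t -> is_derive t 1 s (V (s t)).

Definition arc (R : realType) (V : R * R -> R * R) (D : set (R * R))
    (J : set R) (s : R -> R * R) : Prop :=
  integral_curve V J s /\ forall t, J t -> D (s t).

Definition arcX (R : realType) (Z : nsvf R) : set R -> (R -> R * R) -> Prop :=
  arc (fieldX Z) (closure (@Sigma_pos R)).
Definition arcY (R : realType) (Z : nsvf R) : set R -> (R -> R * R) -> Prop :=
  arc (fieldY Z) (closure (@Sigma_neg R)).
Definition arcZs (R : realType) (Z : nsvf R) : set R -> (R -> R * R) -> Prop :=
  arc (sliding_field Z) (closure (sliding Z) `|` closure (escaping Z)).
Definition any_arc (R : realType) (Z : nsvf R) (J : set R) (s : R -> R * R)
    : Prop :=
  [\/ arcX Z J s, arcY Z J s | arcZs Z J s].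

(* s, restricted to the time interval I, is a local trajectory through p. *)
Definition local_trajectory (R : realType) (Z : nsvf R) (p : R * R)
    (I : set R) (s : R -> R * R) : Prop :=
  let Ipast := I `&` [set t | t <= 0] in
  let Ifuture := I `&` [set t | 0 <= t] in
  [/\ is_interval I, I 0 & s 0 = p] /\
  [/\ (Sigma_pos p -> arcX Z I s) /\ (Sigma_neg p -> arcY Z I s),
      (crossing_pos Z p -> arcY Z Ipast s /\ arcX Z Ifuture s) /\
      (crossing_neg Z p -> arcX Z Ipast s /\ arcY Z Ifuture s),
      (escaping Z p -> arcZs Z Ipast s /\ any_arc Z Ifuture s) /\
      (sliding Z p -> any_arc Z Ipast s /\ arcZs Z Ifuture s),
      regular_tangency Z p -> any_arc Z Ipast s /\ any_arc Z Ifuture s &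
      singular_tangency Z p -> forall t, I t -> s t = p].

(* On [t_i, t_(i+1)] the curve is a local trajectory through its point
   gamma b, whose own time origin corresponds to the global time b. *)
Definition global_trajectory (R : realType) (Z : nsvf R) (gamma : R -> R * R)
    : Prop :=
  exists tau : int -> R,
    [/\ forall i : int, tau i <= tau (i + 1),
        tau n%:Z @[n --> \oo] --> +oo,
        tau (- n%:Z) @[n --> \oo] --> -oo &
        forall i : int, exists2 b : R, tau i <= b <= tau (i + 1) &
          local_trajectory Z (gamma b)
            [set t | tau i - b <= t <= tau (i + 1) - b]
            (fun t => gamma (t + b))].

Definition Omega (R : realType) (Z : nsvf R) (K : set (R * R))
    : set (R -> R * R) :=
  [set gamma | global_trajectory Z gamma /\ forall t, K (gamma t)].

(* When K is bounded the sum is finite on Omega, so that fine loses nothing. *)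
Definition rho (R : realType) (g1 g2 : R -> R * R) : R :=
  fine (\esum_(i in [set: int])
    ((2^-1 ^+ absz i)%:E *
     \int[@lebesgue_measure R]_(t in `[i%:~R%R, (i + 1)%:~R%R])
       (enorm (g1 t - g2 t))%:E)%E).

Definition dyn_dist (R : realType) (W : Type) (d : W -> W -> R) (g : W -> W)
    (n : nat) (x y : W) : R :=
  \big[Num.max/0]_(i < n) d (iter i g x) (iter i g y).

(* The infimum of the empty set is +oo: this is the value when no finite set
   of centers gives a cover. *)
Definition span_number (R : realType) (W : Type) (d : W -> W -> R)
    (g : W -> W) (eps : R) (n : nat) : \bar R :=
  ereal_inf [set k%:R%:E | k in [set k : nat | exists E : set W,
    (E #= `I_k)%card /\ forall y, exists2 x, E x & dyn_dist d g n x y < eps]].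

Definition top_entropy (R : realType) (W : Type) (d : W -> W -> R)
    (g : W -> W) : \bar R :=
  lim (limn_esup (fun n => (n%:R^-1)%:E * lne (span_number d g eps n))%E
        @[eps --> 0^'+]).

Definition shift1 (R : realType) (gamma : R -> R * R) : R -> R * R :=
  fun t => gamma (t + 1).

Lemma Omega_shift1 (R : realType) (Z : nsvf R) (K : set (R * R)) gamma :
  Omega Z K gamma -> Omega Z K (shift1 gamma).
Proof.
move=> [[tau [tau_le tau_p tau_n loc]] gK]; split; last by move=> t; exact: gK.
exists (fun i => tau i - 1); split => [i|||i].
- by rewrite lerD2r.
- apply/cvgryPge => A; have /cvgryPge/(_ (A + 1)) := tau_p.
  by apply: filterS => n; rewrite lerBrDr.
- apply/cvgrNyPle => A; have /cvgrNyPle/(_ (A + 1)) := tau_n.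
  by apply: filterS => n; rewrite lerBlDr.
- have [b /andP[b1 b2] lb] := loc i.
  exists (b - 1); first by rewrite !lerD2r b1.
  rewrite /shift1 subrK.
  rewrite (_ : (fun t => _) = fun t => gamma (t + b)); last first.
    by apply/funext => t; rewrite -addrA subrK.
  have E c : c - 1 - (b - 1) = c - b by rewrite opprB addrA subrK.
  by rewrite !E.
Qed.

Definition F1 (R : realType) (Z : nsvf R) (K : set (R * R))
    (w : {gamma : R -> R * R | Omega Z K gamma})
    : {gamma : R -> R * R | Omega Z K gamma} :=
  exist _ (shift1 (sval w)) (Omega_shift1 (svalP w)).

Definition nsvf_entropy (R : realType) (Z : nsvf R) (K : set (R * R))
    : \bar R :=
  top_entropy (fun w1 w2 : {gamma : R -> R * R | Omega Z K gamma} =>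
                 rho (sval w1) (sval w2))
              (@F1 R Z K).

(* Main.v *)
Require Import Defs.
From HB Require Import structures.
From mathcomp Require Import all_boot all_order all_algebra.
From mathcomp Require Import all_classical all_reals all_analysis.
From mathcomp Require Import measurable_realfun.
From mathcomp Require Import zify ring lra.

Set Implicit Arguments.
Unset Strict Implicit.
Unset Printing Implicit Defensive.

Import Order.TTheory GRing.Theory Num.Theory.
Import numFieldNormedType.Exports.

Local Open Scope classical_set_scope.
Local Open Scope ring_scope.

(* On the line y = 0 the segment 0 < x < 1/sqrt 2 is sliding, its mirror image
   is escaping, and the sliding field points to the left on both.  For every
   0 < a <= 1/2 this gives a periodic orbit through the origin: slide from 0 to
   -a, follow the parabola of X from (-a, 0) to (a, 0), slide back to 0.  The
   period increases continuously from 0 to a value above 1, so each u in (0, 1)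
   yields a block of duration exactly 1 made of a loop of period u followed by
   a loop of period 1 - u.  Blocks can be concatenated freely, and two different
   blocks are at positive L^1 distance.  With N different blocks this produces
   N^n trajectories that are separated during n units of time at a scale that
   does not depend on n; hence the entropy is at least ln N for every N. *)

(** * Arcs of a vector field *)

Definition loop_field (R : realType) : nsvf R :=
  NSVF (fun p => (1, - 2 * p.1)) (fun p => (- 2, - 4 * p.1 ^+ 3 + 2 * p.1)).

Definition loop_region (R : realType) : set (R * R) :=
  [set p | (-1 <= p.1 <= 1) &&
           (p.1 ^+ 4 / 2 - p.1 ^+ 2 / 2 <= p.2 <= 1 - p.1 ^+ 2)].

Section curves.
Context {R : realType}.
Implicit Types (gamma s : R -> R * R) (V : R * R -> R * R) (J : set R).

Lemma is_derive_pair (f g : R -> R) (t df dg : R) :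
  is_derive t 1 f df -> is_derive t 1 g dg ->
  is_derive t 1 (fun u => (f u, g u)) (df, dg).
Proof.
move=> [f1 f2] [g1 g2].
have H : (h^-1 *: (((fun u => (f u, g u)) \o shift t) (h *: (1:R)) - (f t, g t))
   @[h --> 0^']) --> (df, dg).
  have := cvg_pair f1 g1.
  rewrite -/(derive f t 1) -/(derive g t 1) f2 g2.
  exact.
split; first by apply/cvg_ex; exists (df, dg).
exact: (cvg_lim _ H).
Qed.

(** [switch] is linear, so its difference quotients are constant. The regions of the switching line
    thus become sign conditions on second coordinates. *)
Lemma lie_switch V p : lie V (@switch R) p = (V p).2.
Proof.
have dswitch v : 'D_v (@switch R) p = v.2.
  have H : h^-1 *: ((@switch R \o shift p) (h *: v) - @switch R p) @[h --> 0^']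
       --> v.2.
    apply: cvg_near_cst; near=> h.
    rewrite /switch /= addrK scalerA mulVf ?scale1r//.
    by near: h; exact: nbhs_dnbhs_neq.
  exact: cvg_lim H.
by rewrite /lie /grad !dswitch /dotp /= mul0r mul1r add0r.
Unshelve. all: by end_near. Qed.

(** At an interior point of [J] the curve agrees with the formula [s] on a neighbourhood, so the
    derivative transfers; at the ends only continuity is at stake. *)
Lemma arc_intro V (D : set (R * R)) J gamma s : {in J, gamma =1 s} ->
  (forall t, J t -> derivable s t 1) ->
  (forall t, interior J t -> is_derive t 1 s (V (s t))) ->
  (forall t, J t -> D (s t)) -> Defs.arc V D J gamma.
Proof.
move=> E ds Vs Ds; split; last by move=> t Jt; rewrite E ?inE//; exact: Ds.
split.
  apply: (@subspace_eq_continuous _ _ _ s); first by move=> t /E/esym.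
  apply: continuous_in_subspaceT => t /set_mem Jt.
  exact/differentiable_continuous/derivable1_diffP/ds.
move=> t Jt; rewrite E; last by rewrite inE; exact: interior_subset.
apply: (near_eq_is_derive _ (Vs t Jt)).
by apply: filterS Jt => u Ju; rewrite E ?inE.
Qed.

Lemma arc_subset V (D : set (R * R)) I J gamma :
  I `<=` J -> Defs.arc V D J gamma -> Defs.arc V D I gamma.
Proof.
move=> IJ [[c d] i]; split; last by move=> t /IJ; exact: i.
split; first exact: continuous_subspaceW c.
by move=> t It; apply: d; exact: interiorS It.
Qed.
End curves.

(** * Sliding along the switching line *)

Section slide_time.
Context {R : realType}.
Implicit Types x y : R.

(* Time needed to slide from x to 0: the primitive vanishing at 0 of the inverse
   of the sliding speed (1 + 2 x^2) / (2 - 2 x^2). *)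
Definition slide_time x : R :=
  3 / Num.sqrt 2 * atan (Num.sqrt 2 * x) - x.

Lemma slide_timeN x : slide_time (- x) = - slide_time x.
Proof. by rewrite /slide_time mulrN atanN mulrN opprB opprK addrC. Qed.

Lemma slide_time0 : slide_time 0 = 0.
Proof. by rewrite /slide_time mulr0 atan0 mulr0 subr0. Qed.

Lemma is_derive_slide_time x :
  is_derive x 1 slide_time ((2 - 2 * x ^+ 2) / (1 + 2 * x ^+ 2)).
Proof.
have s2 : Num.sqrt 2 != 0 :> R by rewrite sqrtr_eq0 -ltNge.
have D : is_derive x (1:R) (fun y => Num.sqrt 2 * y) (Num.sqrt 2 : R).
  by apply: is_derive_eq; rewrite /GRing.scale /= mulr1.
have C : is_derive x (1:R) (fun y => atan (Num.sqrt 2 * y))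
    ((1 + (Num.sqrt 2 * x) ^+ 2)^-1 * Num.sqrt 2).
  exact: (is_derive1_comp (is_derive1_atan _) D).
have nz : 1 + 2 * x ^+ 2 != 0 by apply: lt0r_neq0; have := sqr_ge0 x; lra.
rewrite /slide_time; apply: is_derive_eq.
rewrite /GRing.scale /= exprMn sqr_sqrtr//.
by field; rewrite nz s2.
Qed.

Lemma continuous_slide_time : continuous slide_time.
Proof.
move=> x; apply/differentiable_continuous/derivable1_diffP.
by case: (is_derive_slide_time x).
Qed.

Lemma slide_time_lt :
  {in `[-1, 1]%R &, {homo slide_time : x y / x < y}}.
Proof.
apply: gtr0_derive1_lt_cc => [x _|x|].
- by case: (is_derive_slide_time x).
- rewrite in_itv/= => /andP[x0 x1]; rewrite derive1E.
  rewrite (@derive_val _ _ _ _ _ _ _ (is_derive_slide_time x)).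
  have ? := sqr_ge0 x.
  apply: divr_gt0; last by lra.
  nra.
- exact/continuous_subspaceT/continuous_slide_time.
Qed.

Lemma slide_time_gt0 x : 0 < x <= 1 -> 0 < slide_time x.
Proof.
move=> /andP[x0 x1]; rewrite -slide_time0 slide_time_lt// in_itv/=.
- by rewrite lerN10 ler01.
- by rewrite x1 andbT (le_trans _ (ltW x0))// lerN10.
Qed.

Lemma slide_time_surj x t : 0 <= x -> 
  - slide_time x <= t <= slide_time x -> exists2 y, - x <= y <= x & slide_time y = t.
Proof.
move=> x0 /andP[tl tr].
have := @IVT _ slide_time (- x) x t _ (continuous_subspaceT continuous_slide_time).
case; first by lra.
  by rewrite slide_timeN ge_min le_max tl tr orbT.
by move=> y; rewrite in_itv/= => ? <-; exists y.
Qed.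

(** Inverse function theorem: [g (c - t)] is the sliding motion that passes 0 at time [c]. The
    interval is open because the derivative of [slide_time] vanishes at -1 and 1. *)
Lemma slide_time_inverse : exists g : R -> R, forall x : R, -1 < x < 1 ->
  g (slide_time x) = x /\
  is_derive (slide_time x) 1 g ((1 + 2 * x ^+ 2) / (2 - 2 * x ^+ 2)).
Proof.
have [g gK] : exists g : R -> R, forall x : R, -1 <= x <= 1 -> g (slide_time x) = x.
  (* Strict monotonicity makes the preimage in [-1, 1] unique; other times get the default value
     0. *)
  exists (fun t => xget 0 [set x | -1 <= x <= 1 /\ slide_time x = t]).
  move=> x x1; case: xgetP => [y _ [y1 yx]|/(_ x)]; last by case.
  case: (ltgtP y x) => // xy.
    by have := @slide_time_lt y x; rewrite !in_itv/= => /(_ y1 x1 xy); lra.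
  by have := @slide_time_lt x y; rewrite !in_itv/= => /(_ x1 y1 xy); lra.
exists g => x /andP[x0 x1]; split; first by apply: gK; rewrite !ltW.
rewrite -invf_div; apply: is_derive_inverse.
- near=> y; apply: gK; apply/andP; split.
    by apply: ltW; near: y; exact: lt_nbhsr.
  by apply: ltW; near: y; exact: lt_nbhsl.
- by near=> y; exact: continuous_slide_time.
- exact: is_derive_slide_time.
- have ? := sqr_ge0 x.
  apply: lt0r_neq0; apply: divr_gt0; last by lra.
  nra.
Unshelve. all: by end_near. Qed.

End slide_time.

(** * Local trajectories *)

Section local_trajectories.
Context {R : realType}.
Implicit Types (Z : nsvf R) (p : R * R) (I : set R) (s gamma : R -> R * R).

(** The regions are disjoint, so all clauses but one are vacuous at [p]. The next two lemmas use in
    the same way that a sliding or escaping point is not a tangency. *)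
Lemma local_trajectory_pos Z p I s : is_interval I -> I 0 -> s 0 = p ->
  Sigma_pos p -> arcX Z I s -> local_trajectory Z p I s.
Proof.
move=> iI I0 sp p0 sX; have nS : ~ Sigma p.
  by move: p0; rewrite /Sigma_pos/Sigma/= => + p0; rewrite p0 ltxx.
split=> //; split; [split|split|split| |] => //.
- by move: p0; rewrite /Sigma_pos/Sigma_neg/= => + p0; rewrite ltNge ltW.
- by case=> /nS.
- by case=> /nS.
- by case=> /nS.
- by case=> /nS.
- by move=> [[/nS]].
- by move=> [[/nS]].
Qed.

Lemma local_trajectory_sliding Z p I s : is_interval I -> I 0 -> s 0 = p ->
  sliding Z p -> arcZs Z I s -> local_trajectory Z p I s.
Proof.
move=> iI I0 sp [S0 Xp Yp] sZ.
have nT : ~ tangency Z p.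
  by case=> _ /eqP; rewrite mulf_eq0 lt_eqF// gt_eqF.
split=> //; split; [split|split|split| |] => //.
- by move: S0; rewrite /Sigma_pos/Sigma/= => ->; rewrite ltxx.
- by move: S0; rewrite /Sigma_neg/Sigma/= => ->; rewrite ltxx.
- by case=> _; rewrite ltNge ltW.
- by case=> _ _; rewrite ltNge ltW.
- by case=> _; rewrite ltNge ltW.
- by move=> _; split; [apply: Or33|]; apply: arc_subset sZ => t [].
- by move=> [/nT].
- by move=> [/nT].
Qed.

Lemma local_trajectory_escaping Z p I s : is_interval I -> I 0 -> s 0 = p ->
  escaping Z p -> arcZs Z I s -> local_trajectory Z p I s.
Proof.
move=> iI I0 sp [S0 Xp Yp] sZ.
have nT : ~ tangency Z p.
  by case=> _ /eqP; rewrite mulf_eq0 gt_eqF// lt_eqF.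
split=> //; split; [split|split|split| |] => //.
- by move: S0; rewrite /Sigma_pos/Sigma/= => ->; rewrite ltxx.
- by move: S0; rewrite /Sigma_neg/Sigma/= => ->; rewrite ltxx.
- by case=> _ _; rewrite ltNge ltW.
- by case=> _; rewrite ltNge ltW.
- by move=> _; split; [|apply: Or33]; apply: arc_subset sZ => t [].
- by case=> _; rewrite ltNge ltW.
- by move=> [/nT].
- by move=> [/nT].
Qed.

Lemma closureP_ball (A : set (R * R)) p :
  (forall e : R, 0 < e -> exists2 q, A q & ball p e q) -> closure A p.
Proof.
move=> H B /nbhs_ballP[e /= e0 eB]; have [q Aq pq] := H e e0.
by exists q; split=> //; exact: eB.
Qed.

(** One segment of the concatenation in [global_trajectory]. The local time origin [c] is free, so
    it can be put where the point is easy to classify. *)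
Definition piece Z gamma (a b : R) := a <= b /\
  exists2 c, a <= c <= b & local_trajectory Z (gamma c)
    [set t | a - c <= t <= b - c] (fun t => gamma (t + c)).

Lemma interval_setlele (a b : R) : is_interval [set t | a <= t <= b].
Proof.
move=> x y /= /andP[ax xb] /andP[ay yb] z /andP[xz zy].
by rewrite (le_trans ax xz) (le_trans zy yb).
Qed.

Lemma interior_setlele (a b t : R) :
  interior [set t | a <= t <= b] t -> a < t < b.
Proof.
have -> : [set t | a <= t <= b] = [set` `[a, b]].
  by apply/seteqP; split=> x; rewrite /= in_itv.
by rewrite interior_itv/= in_itv/=.
Qed.

End local_trajectories.

(** * Arcs of the loop field *)

Section loops.
Context {R : realType}.
Implicit Types (a b m t x : R) (gamma : R -> R * R).
Local Notation Z := (loop_field R).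

Lemma loop_field_Xf p : Xf Z p = - 2 * p.1.
Proof. by rewrite /Xf lie_switch. Qed.

Lemma loop_field_Yf p : Yf Z p = - 4 * p.1 ^+ 3 + 2 * p.1.
Proof. by rewrite /Yf lie_switch. Qed.

(** [Yf] is 2x(1 - 2x^2), and 1/2 is a rational bound below its zero 1/sqrt 2. *)
Lemma loop_field_sliding x : 0 < x <= 1 / 2 -> sliding Z (x, 0).
Proof.
by move=> /andP[x0 x1]; split => //; rewrite ?loop_field_Xf ?loop_field_Yf/=; nra.
Qed.

Lemma loop_field_escaping x : - (1 / 2) <= x < 0 -> escaping Z (x, 0).
Proof.
by move=> /andP[x0 x1]; split => //; rewrite ?loop_field_Xf ?loop_field_Yf/=; nra.
Qed.

(** A factor x cancels between numerator and denominator, so the field is even in x and points to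
    the left on both sides of 0. *)
Lemma loop_field_sliding_field x : - (1 / 2) <= x <= 1 / 2 -> x != 0 ->
  sliding_field Z (x, 0) = (- ((1 + 2 * x ^+ 2) / (2 - 2 * x ^+ 2)), 0).
Proof.
move=> /andP[xl xr] x0; rewrite /sliding_field /patch mem_set; last first.
  case: (ltgtP x 0) x0 => // x0 _.
    by right; apply: loop_field_escaping; rewrite xl.
  by left; apply: loop_field_sliding; rewrite x0.
rewrite /sliding_formula loop_field_Xf loop_field_Yf/=.
have ? : 1 - x ^+ 2 != 0 by apply: lt0r_neq0; nra.
have nz1 : 2 - 2 * x ^+ 2 != 0 by apply: lt0r_neq0; nra.
have nz2 : - 4 * x ^+ 3 + 2 * x - - 2 * x != 0.
  rewrite (_ : _ - _ = 4 * x * (1 - x ^+ 2)); last by ring.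
  by rewrite !mulf_neq0.
apply: injective_projections; rewrite /= /GRing.scale /=; field => //.
exact/andP.
Qed.

Lemma closure_Sigma_pos (p : R * R) : 0 <= p.2 -> closure (@Sigma_pos R) p.
Proof.
move=> p0; apply: closureP_ball => e e0; exists (p.1, p.2 + e / 2).
  by rewrite /Sigma_pos /switch/=; lra.
split => /=; first exact: ballxx.
by rewrite /ball/= opprD addNKr normrN gtr0_norm; lra.
Qed.

Lemma closure_sliding_escaping x : - (1 / 2) <= x <= 1 / 2 ->
  (closure (sliding Z) `|` closure (escaping Z)) (x, 0).
Proof.
move=> /andP[xl xr]; case: (ltgtP x 0) => x0.
- right; apply: subset_closure; apply: loop_field_escaping; lra.
- left; apply: subset_closure; apply: loop_field_sliding; lra.
(* The origin is neither sliding nor escaping, but it is a limit of sliding points from the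
   right. *)
- left; apply: closureP_ball => e e0; exists (Num.min (e / 2) (1 / 2), 0).
    by apply: loop_field_sliding; rewrite lt_min ge_min lexx orbT andbT; lra.
  split => /=; last exact: ballxx.
  rewrite x0 /ball /= sub0r normrN gtr0_norm ?gt_min ?lt_min; last lra.
  by rewrite ltr_pdivrMr// ltr_pMr ?ltr1n.
Qed.

Lemma piece_X gamma a m : 0 < a ->
  (forall t, m - a <= t <= m + a -> gamma t = (t - m, a ^+ 2 - (t - m) ^+ 2)) ->
  piece Z gamma (m - a) (m + a).
Proof.
(* The time origin is put at the apex of the parabola, which lies in [Sigma_pos]. *)
move=> a0 E; split; first lra; exists m; first by lra.
apply: local_trajectory_pos.
- exact: interval_setlele.
- by rewrite /=; lra.
- by rewrite add0r.
- rewrite /Sigma_pos/switch/= E/=; last lra.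
  by rewrite subrr expr0n/= subr0 exprn_gt0.
- apply: (arc_intro (s := fun t => (t, a ^+ 2 - t ^+ 2))).
  + move=> t /set_mem/= ta; rewrite E; last lra.
    by rewrite addrK.
  + move=> t _; suff : is_derive t 1 (fun t => (t, a ^+ 2 - t ^+ 2)) (1, - 2 * t).
      by case.
    apply: is_derive_pair; apply: is_derive_eq; rewrite /GRing.scale /=; ring.
  + move=> t _; apply: is_derive_pair; apply: is_derive_eq.
    by rewrite /GRing.scale /=; ring.
  + move=> t /= ta; apply: closure_Sigma_pos => /=; nra.
Qed.

Variable g : R -> R.
Hypothesis gE : forall x : R, -1 < x < 1 -> g (slide_time x) = x /\
  is_derive (slide_time x) 1 g ((1 + 2 * x ^+ 2) / (2 - 2 * x ^+ 2)).

(* The last hypothesis keeps the origin at an end of the arc, so that the value of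
   the sliding field at this double tangency never matters. *)
Lemma slide_arc gamma a (I : set R) c : 0 <= a <= 1 / 2 ->
  {in I, gamma =1 fun t => (g (c - t), 0)} ->
  (forall t, I t -> - slide_time a <= c - t <= slide_time a) ->
  (forall t, interior I t -> c - t != 0) ->
  arcZs Z I gamma.
Proof.
move=> /andP[a0 a1] E IT I0.
(* [c - t] is the signed time left before reaching 0; its derivative -1 gives the leftward speed. *)
have ex t : I t -> exists x, [/\ - (1 / 2) <= x <= 1 / 2, slide_time x = c - t,
    g (c - t) = x & is_derive t 1 (fun t => (g (c - t), 0 : R))
     (- ((1 + 2 * x ^+ 2) / (2 - 2 * x ^+ 2)), 0)].
  move=> /IT/(slide_time_surj a0)[x xa xt]; exists x.
  have [|gx dg] := gE (x := x); first lra.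
  split=> //; [lra|by rewrite -xt|].
  apply: is_derive_pair; rewrite xt in dg.
  have dc : is_derive t 1 (fun t => c - t) (-1).
    by apply: is_derive_eq; rewrite add0r mul1r.
  have := @is_derive1_comp _ g (fun t => c - t) _ _ _ dg dc.
  by rewrite mulrN1.
apply: (arc_intro (s := fun t => (g (c - t), 0))) => //.
- by move=> t /ex[x [_ _ _ []]].
- move=> t It; have := interior_subset It => /ex[x [x1 xt -> d]].
  rewrite loop_field_sliding_field//.
  by apply: contraNneq (I0 t It) => x0; rewrite -xt x0 slide_time0.
- move=> t /ex[x [x1 xt -> _]]; exact: closure_sliding_escaping.
Qed.

Lemma piece_slide_escaping gamma a m : 0 < a <= 1 / 2 ->
  (forall t, m <= t <= m + slide_time a -> gamma t = (g (m - t), 0)) ->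
  piece Z gamma m (m + slide_time a).
Proof.
move=> /andP[a0 a1] E; have G0 := slide_time_gt0 (x := a) ltac:(lra).
(* The time origin is half-way through the slide, at an escaping point, away from the tangency where
   the slide starts. *)
split; first lra; exists (m + slide_time a / 2); first lra.
set c := m + _.
apply: local_trajectory_escaping.
- exact: interval_setlele.
- by rewrite /= /c; lra.
- by rewrite add0r.
- rewrite E; last by rewrite /c; lra.
  have [|x xa xt] := slide_time_surj (x := a) (t := m - c) ltac:(lra).
    by rewrite /c; lra.
  rewrite -xt (gE _).1; last lra.
  apply: loop_field_escaping; apply/andP; split; first lra.
  rewrite ltNge; apply/negP; rewrite le_eqVlt => /orP[/eqP x0|x0].
    by move: xt; rewrite -x0 slide_time0 /c; lra.
  by have := slide_time_gt0 (x := x); rewrite xt /c; lra.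
- apply: (slide_arc (a := a) (c := - (slide_time a / 2))); first lra.
  + move=> t /set_mem/=; rewrite /c => tc; rewrite E; last lra.
    by congr (g _, _); lra.
  + by move=> t /=; rewrite /c; lra.
  + by move=> t /interior_setlele; rewrite /c => ?; rewrite lt_eqF//; lra.
Qed.

Lemma piece_slide_sliding gamma a m : 0 < a <= 1 / 2 ->
  (forall t, m - slide_time a <= t <= m -> gamma t = (g (m - t), 0)) ->
  piece Z gamma (m - slide_time a) m.
Proof.
move=> /andP[a0 a1] E; have G0 := slide_time_gt0 (x := a) ltac:(lra).
(* Again half-way, now at a sliding point, away from the tangency where the slide ends. *)
split; first lra; exists (m - slide_time a / 2); first lra.
set c := m - _.
apply: local_trajectory_sliding.
- exact: interval_setlele.
- by rewrite /= /c; lra.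
- by rewrite add0r.
- rewrite E; last by rewrite /c; lra.
  have [|x xa xt] := slide_time_surj (x := a) (t := m - c) ltac:(lra).
    by rewrite /c; lra.
  rewrite -xt (gE _).1; last lra.
  apply: loop_field_sliding; apply/andP; split; last lra.
  rewrite ltNge; apply/negP; rewrite le_eqVlt => /orP[/eqP x0|x0].
    by move: xt; rewrite x0 slide_time0 /c; lra.
  have := slide_time_gt0 (x := - x); rewrite slide_timeN xt /c; lra.
- apply: (slide_arc (a := a) (c := slide_time a / 2)); first lra.
  + move=> t /set_mem/=; rewrite /c => tc; rewrite E; last lra.
    by congr (g _, _); lra.
  + by move=> t /=; rewrite /c; lra.
  + by move=> t /interior_setlele; rewrite /c => ?; rewrite gt_eqF//; lra.
Qed.
End loops.

(** * Concatenation and loops *)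

Section chains.
Context {R : realType}.
Implicit Types (Z : nsvf R) (gamma : R -> R * R) (a b c : R).

Definition chain Z gamma n a b := exists tau : nat -> R,
  [/\ tau 0%N = a, tau n = b &
      forall k, (k < n)%N -> piece Z gamma (tau k) (tau k.+1)].

Lemma chain1 Z gamma a b : piece Z gamma a b -> chain Z gamma 1 a b.
Proof.
by move=> ab; exists (fun k => if k is 0 then a else b); split=> // -[].
Qed.

Lemma chain_cat Z gamma m n a b c :
  chain Z gamma m a b -> chain Z gamma n b c -> chain Z gamma (m + n) a c.
Proof.
move=> [s [s0 sm sp]] [t [t0 tn tp]].
exists (fun k => if (k <= m)%N then s k else t (k - m)%N).
split=> [//||k kmn].
- case: leqP => mn; last by rewrite addKn.
  have n0 : n = 0%N by lia.
  by rewrite n0 addn0 sm -t0 -tn n0.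
- case: (ltngtP k m) => km.
  + exact: sp.
  + by rewrite subSn 1?ltnW//; apply: tp; lia.
  + by rewrite km sm subSnn -t0; apply: tp; lia.
Qed.

(** Since every unit interval has the same number of pieces, Euclidean division turns a single index
    into a unit interval and a position in it. *)
Lemma chain_global Z gamma n :
  (forall i : int, chain Z gamma n.+1 i%:~R (i + 1)%:~R) ->
  global_trajectory Z gamma.
Proof.
move=> /choice[T HT].
pose tau (j : int) := T (j %/ n.+1%:Z)%Z `|(j %% n.+1%:Z)%Z|%N.
have Tle q k : (k <= n.+1)%N -> q%:~R <= T q k <= (q + 1)%:~R.
  have [T0 Tn Tp] := HT q => kn.
  have mono (l k' : nat) : (l + k' <= n.+1)%N -> T q l <= T q (l + k')%N.
    elim: k' => [|k' IH] lk; first by rewrite addn0.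
    by rewrite (le_trans (IH _)) ?addnS//; [lia|apply: (Tp _ _).1; lia].
  rewrite -T0 -Tn; apply/andP; split; first by have := mono 0%N k kn.
  by have := mono k (n.+1 - k)%N; rewrite subnKC//; apply.
have r_lt (j : int) : (`|(j %% n.+1%:Z)%Z| < n.+1)%N by lia.
have tauP j : piece Z gamma (tau j) (tau (j + 1)).
  rewrite /tau; set q := (j %/ _)%Z; set r := `|(j %% _)%Z|%N.
  have jE : j = q * n.+1%:Z + r%:Z by lia.
  have [T0 Tn Tp] := HT q; have rn : (r < n.+1)%N := r_lt j.
  have [rn'|rn'] := ltnP r.+1 n.+1.
    have jE1 : j + 1 = q * n.+1%:Z + r.+1%:Z by lia.
    rewrite jE1 divzMDl// modzMDl divz_small ?modz_small ?addr0; try lia.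
    exact: Tp.
  (* Last piece of its unit: the next index has remainder 0, and the subdivisions of consecutive
     units meet at an integer. *)
  have jE1 : j + 1 = (q + 1) * n.+1%:Z by lia.
  rewrite jE1 mulzK// modzMl absz0.
  have [-> _ _] := HT (q + 1); rewrite -Tn.
  by rewrite (_ : n.+1 = r.+1)//; [exact: Tp|lia].
(* The breakpoints stay within 1 of an affine function of the index, hence diverge at both ends. *)
have qle (j : int) : j%:~R / n.+1%:R - 1 <= tau j <= j%:~R / n.+1%:R + 1.
  have /andP[h1 h2] := Tle (j %/ n.+1%:Z)%Z _ (ltnW (r_lt j)).
  have l1 : (j %/ n.+1%:Z)%Z%:~R <= (j%:~R / n.+1%:R : R).
    by rewrite ler_pdivlMr// -[n.+1%:R]/((n.+1%:Z)%:~R) -intrM ler_int lez_floor.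
  have l2 : (j%:~R / n.+1%:R : R) <= ((j %/ n.+1%:Z)%Z + 1)%:~R.
    by rewrite ler_pdivrMr// -[n.+1%:R]/((n.+1%:Z)%:~R) -intrM ler_int ltW// ltz_ceil.
  have between (x y z : R) : y <= x -> x <= y + 1 -> y <= z -> z <= y + 1 ->
    z - 1 <= x <= z + 1 by lra.
  by move: h1 h2 l1 l2; rewrite intrD mulr1z; exact: between.
exists tau; split=> [i|||i]; try by case: (tauP i).
- apply/cvgryPge => A; near=> k.
  have /andP[+ _] := qle k%:Z; apply: le_trans.
  rewrite lerBrDr ler_pdivlMr// -pmulrn; near: k; exact: nbhs_infty_ger.
- apply/cvgrNyPle => A; near=> k.
  have /andP[_] := qle (- k%:Z); move=> /le_trans; apply.
  rewrite -lerBrDr ler_pdivrMr// mulrNz lerNl -pmulrn; near: k; exact: nbhs_infty_ger.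
Unshelve. all: by end_near. Qed.

End chains.

(** * Periods of the loops *)

Section period.
Context {R : realType}.
Implicit Types a u : R.

(** Two slides, and a parabola of width [2 * a] run through at horizontal speed 1. *)
Definition period a : R := 2 * (slide_time a + a).

Lemma period_lt : {in `[-1, 1]%R &, {homo period : x y / x < y}}.
Proof. by move=> x y x1 y1 xy; have := slide_time_lt x1 y1 xy; rewrite /period; lra. Qed.

Lemma period_gt0 a : 0 < a <= 1 / 2 -> 0 < period a.
Proof. by move=> a01; have := slide_time_gt0 (x := a); rewrite /period; lra. Qed.

Lemma radius_exists u : 0 < u <= 1 -> exists2 a, 0 < a <= 1 / 2 & period a = u.
Proof.
move=> /andP[u0 u1].
have p0 : period 0 = 0 by rewrite /period slide_time0 addr0 mulr0.
(* At radius 1/2 the parabola alone takes time 1. *)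
have p1 : 1 <= period (1 / 2).
  by have := slide_time_gt0 (x := 1 / 2 : R); rewrite /period; lra.
have cp : continuous period.
  by move=> x; apply: cvgMr; apply: cvgD => //; exact: continuous_slide_time.
have := @IVT _ period 0 (1 / 2) u _ (continuous_subspaceT cp).
case; first lra.
  by rewrite p0 ge_min le_max; apply/andP; split; apply/orP; [left|right]; lra.
move=> a; rewrite in_itv/= => /andP[a0 a1] pa; exists a => //; rewrite a1 andbT.
by rewrite lt_neqAle a0 andbT; apply: contraTneq u0 => a00; rewrite -pa -a00 p0 ltxx.
Qed.

Lemma radius_map : exists r : R -> R, forall u, 0 < u <= 1 ->
  0 < r u <= 1 / 2 /\ period (r u) = u.
Proof.
have /choice[r rP] : forall u, exists a, 0 < u <= 1 ->
    0 < a <= 1 / 2 /\ period a = u.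
  move=> u; have [/radius_exists[a ? ?]|_] := boolP (0 < u <= 1).
    by exists a.
  by exists 0.
by exists r.
Qed.

End period.

(** * Loops, blocks and coded trajectories *)

Section loops.
Context {R : realType}.
Local Notation Z := (loop_field R).
Variable g : R -> R.
Hypothesis gE : forall x : R, -1 < x < 1 -> g (slide_time x) = x /\
  is_derive (slide_time x) 1 g ((1 + 2 * x ^+ 2) / (2 - 2 * x ^+ 2)).
Implicit Types (a b s t x : R) (gamma : R -> R * R).

Definition loop a t : R * R :=
  if t <= slide_time a then (g (- t), 0)
  else if t <= slide_time a + 2 * a then
    (t - slide_time a - a, a ^+ 2 - (t - slide_time a - a) ^+ 2)
  else (g (period a - t), 0).

Lemma inverse0 : g 0 = 0.
Proof. by have [] := gE (x := 0); [lra|rewrite slide_time0]. Qed.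

Lemma loop0 a : 0 < a <= 1 / 2 -> loop a 0 = (0, 0).
Proof.
move=> a01; have := slide_time_gt0 (x := a); rewrite /loop oppr0 inverse0.
by move=> G0; rewrite ltW// G0; lra.
Qed.

Lemma loop_period a : 0 < a <= 1 / 2 -> loop a (period a) = (0, 0).
Proof.
move=> a01; have := slide_time_gt0 (x := a) ltac:(lra) => G0.
rewrite /loop subrr inverse0 ifF; last by apply/negbTE; rewrite -ltNge /period; lra.
by rewrite ifF//; apply/negbTE; rewrite -ltNge /period; lra.
Qed.

Lemma g_slide_time x : -1 < x < 1 -> g (slide_time x) = x.
Proof. by move=> /gE[]. Qed.

Lemma chain_loop gamma a s : 0 < a <= 1 / 2 ->
  (forall t, s <= t <= s + period a -> gamma t = loop a (t - s)) ->
  chain Z gamma 3 s (s + period a).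
Proof.
move=> a01 E; have := slide_time_gt0 (x := a) ltac:(lra) => G0.
set m := s + slide_time a + a.
have e1 : s + slide_time a = m - a by rewrite /m; ring.
have e2 : s + period a - slide_time a = m + a by rewrite /m /period; ring.
apply: (@chain_cat _ _ _ 1 2 _ (s + slide_time a)).
  apply: chain1; apply: (piece_slide_escaping gE) => // t /andP[t0 t1].
  by rewrite E /loop ?ifT ?opprB//; rewrite ?/period; lra.
rewrite e1; apply: (@chain_cat _ _ _ 1 1 _ (m + a)).
  apply: chain1; apply: piece_X; first lra.
  move=> t; rewrite /m => tm; rewrite E /loop /period; last lra.
  (* At the junction time [loop] still selects the slide; both formulas give (-a, 0). *)
  have [t1|t1] := leP (t - s) (slide_time a).
    have -> : t = s + slide_time a by lra.
    rewrite (_ : - _ = slide_time (- a)); last by rewrite slide_timeN; ring.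
    rewrite g_slide_time; last lra.
    by congr (_, _); ring.
  rewrite ifT; last lra.
  by congr (_, _); ring.
rewrite -e2; apply: chain1; apply: (piece_slide_sliding gE) => //.
move=> t /andP[t0 t1]; rewrite E /loop; last by rewrite /period in t0 t1 *; lra.
rewrite ifF; last by apply/negbTE; rewrite -ltNge; move: t0; rewrite /period; lra.
(* At the second junction the parabola is still selected; both formulas give (a, 0). *)
have [t2|t2] := leP (t - s) (slide_time a + 2 * a).
  have -> : t = s + slide_time a + 2 * a by move: t0; rewrite /period; lra.
  rewrite (_ : s + _ - _ = slide_time a); last by rewrite /period; ring.
  rewrite g_slide_time; last lra.
  by congr (_, _); ring.
by congr (g _, _); ring.
Qed.

Lemma loop_field_region_slide x : - (1 / 2) <= x <= 1 / 2 -> loop_region (x, 0).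
Proof.
move=> x1; apply/andP; split=> /=; first lra.
have : 0 <= x ^+ 2 <= 1 / 4 by rewrite sqr_ge0/=; nra.
by rewrite (exprM x 2 2); move: (x ^+ 2) => y y1; apply/andP; split; nra.
Qed.

Lemma loop_in_region a t : 0 < a <= 1 / 2 -> 0 <= t <= period a ->
  loop_region (loop a t).
Proof.
move=> a01; rewrite /period /loop => tp.
have := slide_time_gt0 (x := a) ltac:(lra) => G0.
have slide_in v : - slide_time a <= v <= slide_time a -> loop_region (g v, 0).
  move=> /slide_time_surj[|x x1 <-]; first lra.
  by rewrite g_slide_time; [apply: loop_field_region_slide; lra|lra].
case: leP => t1; first by apply: slide_in; lra.
case: leP => t2; last by apply: slide_in; rewrite /period; lra.
apply/andP; split=> /=; first lra.
set v := t - _ - _; have : - a <= v <= a by rewrite /v; lra.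
move: v => v va; apply/andP; split; last by nra.
(* With y = v^2 <= a^2 <= 1, the lower boundary satisfies (y^2 - y)/2 <= 0 <= a^2 - y. *)
have : 0 <= v ^+ 2 <= a ^+ 2 by rewrite sqr_ge0/=; nra.
have : a ^+ 2 <= 1 by nra.
by rewrite (exprM v 2 2); move: (v ^+ 2) => y y1; nra.
Qed.

Definition block a b t := if t <= period a then loop a t else loop b (t - period a).

Definition coded (a b : int -> R) t :=
  block (a (Num.floor t)) (b (Num.floor t)) (t - (Num.floor t)%:~R).

Section coded.
Variables a b : int -> R.
Hypothesis a01 : forall i, 0 < a i <= 1 / 2.
Hypothesis b01 : forall i, 0 < b i <= 1 / 2.
Hypothesis ab1 : forall i, period (a i) + period (b i) = 1.

(** At the right end the floor jumps to [i + 1], but block [i] ends at the origin, where the next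
    block starts. *)
Lemma coded_block (i : int) t : i%:~R <= t <= (i + 1)%:~R ->
  coded a b t = block (a i) (b i) (t - i%:~R).
Proof.
move=> /andP[it]; rewrite le_eqVlt => /predU1P[->|ti]; last first.
  by rewrite /coded (@floor_def _ _ i)// it ti.
have pa := period_gt0 (a01 i); have pb := period_gt0 (b01 i).
rewrite /coded intrKfloor subrr /block ltW ?period_gt0// loop0//.
rewrite intrD mulr1z addrC addKr ifF; last first.
  by apply/negbTE; rewrite -ltNge -(ab1 i) ltrDl.
by rewrite -(ab1 i) addrC addKr loop_period.
Qed.

Lemma coded_global : global_trajectory Z (coded a b).
Proof.
(* Six pieces per unit of time, three for each of the two loops; the argument 5 is the predecessor
   of 6. *)
apply: (@chain_global _ _ _ 5) => i.
have pa := period_gt0 (a01 i); have pb := period_gt0 (b01 i).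
apply: (@chain_cat _ _ _ 3 3 _ (i%:~R + period (a i))).
  apply: chain_loop => // t ti.
  rewrite (@coded_block i); last first.
    by rewrite intrD mulr1z; move: (ab1 i); lra.
  by rewrite /block ifT//; lra.
have -> : (i + 1)%:~R = i%:~R + period (a i) + period (b i).
  by rewrite -addrA ab1 intrD.
apply: chain_loop => // t ti.
rewrite (@coded_block i); last first.
  by rewrite intrD mulr1z; move: (ab1 i); lra.
rewrite /block; case: leP => tp; last by rewrite opprD addrA.
have -> : t = i%:~R + period (a i) by lra.
by rewrite subrr loop0// addrC addKr loop_period.
Qed.

Lemma coded_in_region t : loop_region (coded a b t).
Proof.
rewrite /coded /block; set i := Num.floor t.
have := floor_itv t; rewrite -/i intrD mulr1z => ti.
by case: leP => tp; apply: loop_in_region => //; move: (ab1 i); lra.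
Qed.

End coded.

(** Just after time [slide_time a] the smaller loop is in the air on its parabola while the larger
    one still slides at height 0. *)
Lemma block_separated a b a' b' :
  0 < a <= 1 / 2 -> 0 < a' <= 1 / 2 -> a < a' -> period a' <= 1 ->
  exists l h e, [/\ 0 <= l, l < h, h <= 1, 0 < e &
    forall t, l <= t <= h -> e <= enorm (block a b t - block a' b' t)].
Proof.
move=> a01 a'01 aa' p1.
have G0 := slide_time_gt0 (x := a) ltac:(lra).
have GG' : slide_time a < slide_time a'.
  by apply: slide_time_lt => //; rewrite in_itv/=; lra.
(* On the window of length [d], the larger loop has not finished its first slide and the smaller one
   has not passed its apex. *)
pose d := Num.min (slide_time a' - slide_time a) a / 2.
have d0 : 0 < d by rewrite divr_gt0// lt_min; lra.
have [d1 d2] : 2 * d <= slide_time a' - slide_time a /\ 2 * d <= a.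
  by rewrite /d mulrC divfK// !ge_min !lexx orbT.
exists (slide_time a + d), (slide_time a + 2 * d), (a * d).
move: p1; rewrite /period => p1.
split; try lra; first by rewrite mulr_gt0//; lra.
move=> t tl; rewrite /block /loop /period.
rewrite ifT; last lra.
rewrite ifF; last by apply/negbTE; rewrite -ltNge; lra.
rewrite ifT; last lra.
rewrite ifT; last lra.
rewrite ifT; last lra.
rewrite /enorm /dotp /= subr0.
set v := t - _ - _.
apply: (@le_trans _ _ (Num.sqrt ((a ^+ 2 - v ^+ 2) * (a ^+ 2 - v ^+ 2)))); last first.
  by rewrite ler_wsqrtr// lerDr -expr2 sqr_ge0.
rewrite -expr2 sqrtr_sqr; apply: le_trans (ler_norm _).
(* The height a^2 - v^2 = (a - v)(a + v) is at least a d. *)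
have : - a + d <= v <= 0 by rewrite /v; lra.
nra.
Qed.

End loops.

(** * Metric estimates *)

Section measurability.
Context {R : realType}.
Implicit Types (Z : nsvf R) (p : R * R) (I : set R) (s gamma : R -> R * R).

Lemma any_arc_continuous Z I s : any_arc Z I s -> {within I, continuous s}.
Proof. by case=> -[[]]. Qed.

(** The clauses constrain past and future separately, and every point of the plane falls under one
    of them. *)
Lemma local_trajectory_continuous Z p I s : local_trajectory Z p I s ->
  {within I `&` [set t | t <= 0], continuous s} /\
  {within I `&` [set t | 0 <= t], continuous s}.
Proof.
move=> [[_ I0 sp] [[pos neg] [cpos cneg] [esc sli] reg sing]].
have sub A : {within I, continuous s} -> {within I `&` A, continuous s}.
  by apply: continuous_subspaceW => t [].
have [p0|p0|p0] := ltgtP (switch p) 0.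
- by have [[c _] _] := neg p0; split; exact: sub.
- by have [[c _] _] := pos p0; split; exact: sub.
have [/eqP T0|] := eqVneq (Xf Z p * Yf Z p) 0.
  have [S|S] := pselect ((invisible_X Z `&` invisible_Y Z) p).
    have cst A : {within I `&` A, continuous s}.
      apply: (@subspace_eq_continuous _ _ _ (cst p)).
        move=> t /set_mem[It _]; apply/esym/sing => //.
        by split=> //; split=> //; apply/eqP.
      by apply: continuous_subspaceT => x; exact: cvg_cst.
    by split; exact: cst.
  have [|a1 a2] := reg _; first by split=> //; split=> //; apply/eqP.
  by split; [exact: any_arc_continuous a1|exact: any_arc_continuous a2].
rewrite mulf_eq0 negb_or => /andP[].
case: (ltgtP (Xf Z p) 0) => // X0 _; case: (ltgtP (Yf Z p) 0) => // Y0 _.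
- by have [|[[? _] _] [[? _] _]] := cneg _.
- by have [|a1 [[? _] _]] := sli _; split=> //; exact: any_arc_continuous a1.
- by have [|[[? _] _] a2] := esc _; split=> //; exact: any_arc_continuous a2.
- by have [|[[? _] _] [[? _] _]] := cpos _.
Qed.

Lemma measurable_fun_countable_cover (U : Type) (F : U -> set R) (f : R -> R) :
  countable [set: U] -> (forall i, measurable (F i)) ->
  (forall i, measurable_fun (F i) f) -> (forall t, exists i, F i t) ->
  measurable_fun setT f.
Proof.
move=> cU mF mf cov _ A mA.
rewrite (_ : _ `&` _ = \bigcup_i (F i `&` f @^-1` A)).
  by apply: countable_bigcupT_measurable => // i; exact: mf.
apply/seteqP; split=> t; last by move=> [i _ []].
by move=> [_ At]; have [i Fi] := cov t; exists i.
Qed.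

(** Starting from a breakpoint before [t], if no interval contained [t] then all later breakpoints
    would stay before [t]. *)
Lemma global_trajectory_cover (tau : int -> R) t :
  tau n%:Z @[n --> \oo] --> +oo -> tau (- n%:Z) @[n --> \oo] --> -oo ->
  exists i, tau i <= t <= tau (i + 1).
Proof.
move=> /cvgryPgt/(_ t)[n _ tn] /cvgrNyPle/(_ t)[m _ tm].
apply: contrapT => none.
have below k : tau (- m%:Z + k%:Z) <= t.
  elim: k => [|k IH]; first by rewrite addr0; apply: tm => /=.
  rewrite leNgt; apply/negP => /ltW tk; apply: none; exists (- m%:Z + k%:Z).
  by rewrite IH/= -addrA; rewrite (_ : k%:Z + 1 = k.+1%:Z)//; lia.
have := tn n (leqnn n); rewrite ltNge => /negP; apply.
by have := below (m + n)%N; rewrite PoszD addKr.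
Qed.

(** The centers of a cover are arbitrary elements of [Omega], so the integral triangle inequality
    has to apply to all of them. Each one is continuous on countably many closed intervals that
    cover the line. *)
Lemma global_trajectory_measurable Z gamma : global_trajectory Z gamma ->
  measurable_fun setT (fst \o gamma) /\ measurable_fun setT (snd \o gamma).
Proof.
move=> [tau [_ tp tn loc]].
suff H (f : R * R -> R) : continuous f -> measurable_fun setT (f \o gamma).
  by split; apply: H => x; [exact: cvg_fst|exact: cvg_snd].
move=> cf.
have /choice[c cP] i : exists c, tau i <= c <= tau (i + 1) /\
  measurable_fun [set` `[tau i, c]] (f \o gamma) /\
  measurable_fun [set` `[c, tau (i + 1)]] (f \o gamma).
  have [c ci /local_trajectory_continuous[c1 c2]] := loc i.
  exists c; split=> //.
  have go (J : set R) (l r : R) : {within J, continuous (fun t => gamma (t + c))} ->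
      J = [set` `[l - c, r - c]] -> measurable_fun [set` `[l, r]] (f \o gamma).
    move=> cJ JE; rewrite JE in cJ.
    have -> : f \o gamma = (fun t => f (gamma (t + c))) \o (fun t => t - c).
      by apply/funext => t /=; rewrite subrK.
    apply: (@measurable_comp _ _ _ _ _ _ [set` `[l - c, r - c]]).
    - exact: measurable_itv.
    - by move=> _ /= [t + <-]; rewrite !in_itv/= !lerD2r.
    - apply: subspace_continuous_measurable_fun; first exact: measurable_itv.
      by move=> x; apply: continuous_comp; [exact: cJ|exact: cf].
    - exact: measurable_funB.
  split; [apply: (go _ _ _ c1)|apply: (go _ _ _ c2)]; apply/seteqP;
    split => t /=; rewrite in_itv/= subrr.
  + by case=> /andP[-> _] ->.
  + by move=> /andP[-> t0]; split=> //=; lra.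
  + by case=> /andP[_ ->] ->.
  + by move=> /andP[t0 ->]; rewrite t0 andbT; split=> //; lra.
pose F (ib : int * bool) := if ib.2 then [set` `[tau ib.1, c ib.1]]
  else [set` `[c ib.1, tau (ib.1 + 1)]].
apply: (@measurable_fun_countable_cover _ F).
- exact: countableP.
- by move=> [i []]; exact: measurable_itv.
- by move=> [i []]; have [_ []] := cP i.
- move=> t; have [i it] := global_trajectory_cover t tp tn.
  have [ci _] := cP i.
  have [tc|tc] := leP t (c i); [exists (i, true)|exists (i, false)];
    rewrite /F /= in_itv/=; lra.
Qed.

End measurability.

(** * Bounds for the metric on trajectories *)

Section distance.
Context {R : realType}.
Implicit Types (u v w : R -> R * R).
Local Notation Z := (loop_field R).
Local Notation K := (@loop_region R).
Local Notation mu := (@lebesgue_measure R).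

Lemma enorm_ge0 (p : R * R) : 0 <= enorm p.
Proof. exact: sqrtr_ge0. Qed.

Lemma enormN (p : R * R) : enorm (- p) = enorm p.
Proof. by rewrite /enorm /dotp /= !mulrNN. Qed.

Lemma enormD (p q : R * R) : enorm (p + q) <= enorm p + enorm q.
Proof.
rewrite -(@ler_pXn2r _ 2)// ?nnegrE ?addr_ge0 ?enorm_ge0//.
rewrite sqrrD /enorm /dotp.
have sq (x y : R) : 0 <= x * x + y * y by rewrite addr_ge0// -expr2 sqr_ge0.
rewrite !sqr_sqrtr ?sq// -sqrtrM ?sq//=.
set S := Num.sqrt _.
suff : p.1 * q.1 + p.2 * q.2 <= S by lra.
apply: le_trans (ler_norm _) _; rewrite -sqrtr_sqr ler_wsqrtr//.
(* Cauchy-Schwarz through the identity of Lagrange. *)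
have := sqr_ge0 (p.1 * q.2 - p.2 * q.1); nra.
Qed.

(** The region lies in the rectangle [-1, 1] x [-1/2, 1], whose diagonal is 5/2. *)
Lemma region_enorm_le (p q : R * R) : K p -> K q -> enorm (p - q) <= 3.
Proof.
move=> /andP[p1 /andP[p2 p3]] /andP[q1 /andP[q2 q3]].
have low (x : R) : - (1 / 2) <= x ^+ 4 / 2 - x ^+ 2 / 2.
  by rewrite (exprM x 2 2); move: (x ^+ 2) => y; nra.
have lp := low p.1; have lq := low q.1.
have sp := sqr_ge0 p.1; have sq := sqr_ge0 q.1.
rewrite -(@ler_pXn2r _ 2)// ?nnegrE ?enorm_ge0// /enorm /dotp sqr_sqrtr/=; last first.
  by rewrite addr_ge0// -expr2 sqr_ge0.
have : - 2 <= p.1 - q.1 <= 2 by lra.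
have : - (3 / 2) <= p.2 - q.2 <= 3 / 2 by lra.
move: (p.1 - q.1) (p.2 - q.2) => x y; nra.
Qed.

Lemma Omega_enorm_measurable u v : Omega Z K u -> Omega Z K v ->
  measurable_fun setT (fun t => (enorm (u t - v t))%:E).
Proof.
move=> [/global_trajectory_measurable[u1 u2] _] [/global_trajectory_measurable[v1 v2] _].
apply/measurable_EFinP.
apply: (@measurableT_comp _ _ _ _ _ _ (@Num.sqrt R) _
  (fun t => dotp (u t - v t) (u t - v t))).
  by apply: continuous_measurable_fun; exact: sqrt_continuous.
by apply: measurable_funD; apply: measurable_funM; apply: measurable_funB.
Qed.

(** The term of index 0 in [rho]; iterating [F1] moves later unit intervals to this place. *)
Definition unit_dist u v : \bar R :=
  (\int[mu]_(t in `[0%R, 1%R]) (enorm (u t - v t))%:E)%E.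

Lemma unit_dist_triangle w u v : Omega Z K w -> Omega Z K u -> Omega Z K v ->
  (unit_dist u v <= unit_dist w u + unit_dist w v)%E.
Proof.
move=> Ow Ou Ov; rewrite /unit_dist -ge0_integralD//=.
- apply: ge0_le_integral => //=.
  + by move=> t _; rewrite lee_fin enorm_ge0.
  + exact: measurable_funTS (Omega_enorm_measurable Ou Ov).
  + by apply: emeasurable_funD; apply: measurable_funTS; exact: Omega_enorm_measurable.
  + move=> t _; rewrite -EFinD lee_fin -[enorm (w t - u t)]enormN opprB.
    by apply: le_trans (enormD _ _); rewrite addrA subrK.
- by move=> t _; rewrite lee_fin enorm_ge0.
- exact: measurable_funTS (Omega_enorm_measurable Ow Ou).
- by move=> t _; rewrite lee_fin enorm_ge0.
- exact: measurable_funTS (Omega_enorm_measurable Ow Ov).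
Qed.

Lemma unit_dist_ge u v l h e : Omega Z K u -> Omega Z K v ->
  0 <= l -> l < h -> h <= 1 -> 0 < e ->
  (forall t, l <= t <= h -> e <= enorm (u t - v t)) ->
  ((e * (h - l))%:E <= unit_dist u v)%E.
Proof.
move=> Ou Ov l0 lh h1 e0 eP.
have muv := Omega_enorm_measurable Ou Ov.
apply: (@le_trans _ _ (\int[mu]_(t in `[l, h]) (enorm (u t - v t))%:E)%E); last first.
  apply: ge0_subset_integral => //=.
  - exact: measurable_funTS.
  - by move=> t _; rewrite lee_fin enorm_ge0.
  - by move=> t; rewrite /= !in_itv/=; lra.
apply: (@le_trans _ _ (\int[mu]_(t in `[l, h]) (cst e%:E t))%E).
  by rewrite integral_cst//= lebesgue_measure_itv/= lte_fin lh -EFinB -EFinM.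
apply: ge0_le_integral => //=.
- by move=> t _; rewrite lee_fin ltW.
- exact: measurable_funTS.
Qed.

(** The factor 3 is the diameter bound of the region. Nonnegative and negative indices each
    contribute at most 6; [Negz n] has absolute value n + 1, whence the shift by 1. *)
Lemma geometric_int_bound :
  (\esum_(i in [set: int]) (2^-1 ^+ absz i * 3 : R)%:E <= 12%:E)%E.
Proof.
pose B : set int := [set i : int | 0 <= i].
have pos (i : int) : (0 <= (2^-1 ^+ absz i * 3 : R)%:E)%E by [].
have geom k : (\esum_(n in [set: nat]) (2^-1 ^+ (n + k) * 3 : R)%:E <= 6%:E)%E.
  rewrite -nneseries_esumT; last by move=> n; rewrite lee_fin.
  apply: le_trans (epsilon_trick0 xpredT (_ : 0 <= 6 :> R)) => //.
  apply: lee_nneseries => n _ //.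
  rewrite lee_fin natrX exprS invfM -exprVn.
  have : 2^-1 ^+ (n + k) <= 2^-1 ^+ n :> R.
    by apply: ler_wiXn2l; rewrite ?leq_addr//; lra.
  lra.
rewrite (@esumID _ _ B)// !setTI (_ : 12 = 6 + 6 :> R); last by ring.
rewrite EFinD leeD//.
- rewrite (@reindex_esum _ _ _ [set: nat] _ Posz).
    by apply: le_trans (geom 0%N); apply: le_esum => n _; rewrite addn0.
  split; [by []|by move=> m n _ _ []|].
  by move=> [n|//] _; exists n.
- rewrite (@reindex_esum _ _ _ [set: nat] _ Negz).
    by apply: le_trans (geom 1%N); apply: le_esum => n _; rewrite addn1.
  split; [by move=> n _ /=; rewrite /B/=|by move=> m n _ _ []|].
  by move=> [n /(_ isT)//|n _]; exists n.
Qed.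

(* fine sends +oo to 0, whence the need for the summability of the series. *)
Lemma unit_dist_le_rho u v : Omega Z K u -> Omega Z K v ->
  (unit_dist u v <= (rho u v)%:E)%E.
Proof.
move=> Ou Ov; rewrite /rho; set T := fun i : int => (_ * _)%E.
have T0 i : (0 <= T i)%E.
  rewrite mule_ge0// ?lee_fin ?exprn_ge0//.
  by apply: integral_ge0 => t _; rewrite lee_fin enorm_ge0.
have S0 : (0 <= \esum_(i in [set: int]) T i)%E by apply: esum_ge0.
have Sfin : (\esum_(i in [set: int]) T i)%E \is a fin_num.
  rewrite ge0_fin_numE//; apply: le_lt_trans (ltry 12).
  apply: le_trans geometric_int_bound; apply: le_esum => i _.
  rewrite EFinM lee_wpmul2l ?lee_fin ?exprn_ge0//.
  apply: (@le_trans _ _ (\int[mu]_(t in `[i%:~R, (i + 1)%:~R]) (cst 3%:E t))%E).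
    apply: ge0_le_integral => //=.
    - by move=> t _; rewrite lee_fin enorm_ge0.
    - exact: measurable_funTS (Omega_enorm_measurable Ou Ov).
    - by move=> t _; rewrite lee_fin region_enorm_le//; [apply: Ou.2|apply: Ov.2].
  rewrite integral_cst//= lebesgue_measure_itv/= lte_fin ltr_int ltrDl ltr01.
  by rewrite -EFinB -EFinM lee_fin intrD mulr1z addrAC subrr add0r mulr1.
rewrite fineK//.
apply: (@le_trans _ _ (\esum_(i in [set 0%R : int]) T i)%E).
  by rewrite esum_set1// /T /= expr0 mul1e add0r.
rewrite [leRHS](@esumID _ _ [set 0 : int] setT T)// setTI.
by rewrite leeDl// esum_ge0.
Qed.

End distance.

(** * Entropy *)

Section entropy.
Context {R : realType}.

(** Pigeonhole: a ball contains at most one of the points [y t], so choosing a center for each is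
    injective. *)
Lemma span_number_ge (W : Type) (d : W -> W -> R) (g : W -> W) (eps : R) n
    (T : finType) (y : T -> W) :
  (forall x s t, s != t -> dyn_dist d g n x (y s) < eps ->
    dyn_dist d g n x (y t) < eps -> False) ->
  (#|T|%:R%:E <= span_number d g eps n)%E.
Proof.
move=> sep; apply: le_ereal_inf_tmp => _ [k [E [Ek cov]] <-].
rewrite lee_fin ler_nat.
have /card_set_bijP[f [fE finj _]] := Ek.
have /choice[x xP] : forall t, exists x, E x /\ dyn_dist d g n x (y t) < eps.
  by move=> t; have [x Ex ?] := cov (y t); exists x.
pose c t : 'I_k := Ordinal (fE _ (xP t).1).
suff cinj : injective c by rewrite -[k]card_ord; exact: (leq_card c).
move=> s t [/finj] /(_ (mem_set (xP s).1) (mem_set (xP t).1)) xst.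
apply/eqP; apply: contraT => st; exfalso.
by apply: (sep (x s) s t st (xP s).2); rewrite xst; exact: (xP t).2.
Qed.

(** Every tail contains a positive index. Index 0 is left out because the factor 1/n is 0 there by
    convention. *)
Lemma limn_esup_ge (u : (\bar R)^nat) c :
  (forall n, (0 < n)%N -> (c <= u n)%E) -> (c <= limn_esup u)%E.
Proof.
move=> cu; apply: le_ereal_inf_tmp => _ [A [m _ mA] <-].
apply: le_trans (cu m.+1 isT) _.
by apply: ereal_sup_ubound; exists m.+1 => //; apply: mA => /=.
Qed.

(** [delta] may depend on [N] but not on [n], so for each small [eps] the upper limit in [n] is at
    least ln (N + 1). *)
Lemma top_entropy_pinfty (W : Type) (d : W -> W -> R) (g : W -> W) :
  (forall N, exists2 delta : R, 0 < delta & forall eps n, 0 < eps < delta ->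
    ((N.+1 ^ n)%:R%:E <= span_number d g eps n)%E) ->
  top_entropy d g = +oo%E.
Proof.
move=> H; apply: cvg_lim => //; apply/cvgeyPge => A.
have [N AN] : exists N, A <= ln (N.+1%:R : R).
  (* This choice makes N + 1 exceed exp A. *)
  exists (Num.truncn (expR A)).
  by rewrite -[leLHS]expRK ler_ln ?posrE ?expR_gt0// ltW// truncnS_gt.
have [delta delta0 spanP] := H N.
near=> eps.
apply: (@le_trans _ _ (ln (N.+1%:R : R))%:E); first by rewrite lee_fin.
apply: limn_esup_ge => n n0.
have eps_in : 0 < eps < delta.
  by apply/andP; split; near: eps; [exact: nbhs_right_gt|exact: nbhs_right_lt].
have := spanP eps n eps_in.
set s := span_number _ _ _ _ => Ns.
have Nn0 : (0 < (N.+1 ^ n)%:R :> R) by rewrite ltr0n expn_gt0.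
apply: (@le_trans _ _ (n%:R^-1%:E * lne (N.+1 ^ n)%:R%:E)%E).
  rewrite lne_EFin// natrX lnXn// -EFinM lee_fin.
  by rewrite mulrnAr -mulrnAl -[_^-1 *+ n]mulr_natr mulVf ?mul1r// pnatr_eq0 -lt0n.
rewrite lee_wpmul2l ?lee_fin ?invr_ge0// lee_lne// in_itv/= leey andbT.
  by rewrite lee_fin ltW.
by apply: le_trans Ns; rewrite lee_fin ltW.
Unshelve. all: by end_near. Qed.

Local Notation Z := (loop_field R).
Local Notation K := (@loop_region R).
Local Notation W := {gamma : R -> R * R | Omega Z K gamma}.
Local Notation d := (fun w1 w2 : W => rho (sval w1) (sval w2)).

Lemma iter_F1 n (w : W) : sval (iter n (@F1 R Z K) w) = fun t => sval w (t + n%:R).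
Proof.
elim: n => [|n IH]; first by apply/funext => t; rewrite addr0.
by rewrite iterS /F1/= IH /shift1; apply/funext => t; rewrite -addrA nat1r.
Qed.

(** By the triangle inequality at iterate [i], two points of one ball would be less than
    [2 * eps < delta] apart there. *)
Lemma dyn_dist_separated (delta eps : R) n (x y z : W) i : (i < n)%N ->
  eps < delta / 2 ->
  (delta%:E <= unit_dist (fun t => sval y (t + i%:R)%R)
                         (fun t => sval z (t + i%:R)%R))%E ->
  dyn_dist d (@F1 R Z K) n x y < eps -> dyn_dist d (@F1 R Z K) n x z < eps -> False.
Proof.
move=> ni ed; rewrite -!iter_F1 => dyz.
have dle (v : W) : dyn_dist d (@F1 R Z K) n x v < eps ->
    (unit_dist (sval (iter i (@F1 R Z K) x)) (sval (iter i (@F1 R Z K) v)) <= eps%:E)%E.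
  move=> xv; apply: le_trans (unit_dist_le_rho (svalP _) (svalP _)) _.
  rewrite lee_fin ltW//; apply: le_lt_trans xv.
  by rewrite /dyn_dist; rewrite (bigD1 (Ordinal ni))//= le_max lexx.
move=> xy xz; have := unit_dist_triangle (svalP (iter i (@F1 R Z K) x))
  (svalP (iter i (@F1 R Z K) y)) (svalP (iter i (@F1 R Z K) z)).
move=> /(le_trans dyz)/le_trans/(_ (leeD (dle _ xy) (dle _ xz))).
by rewrite -EFinD lee_fin; lra.
Qed.

Lemma loop_field_separated (N : nat) : exists2 delta : R, 0 < delta &
  forall eps n, 0 < eps < delta ->
    ((N.+1 ^ n)%:R%:E <= span_number d (@F1 R Z K) eps n)%E.
Proof.
have [g gE] := @slide_time_inverse R.
have [r rP] := @radius_map R.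
(* N + 1 equally spaced periods strictly inside (0, 1), so that the second loop of each block also
   has positive period. *)
pose u (k : 'I_N.+1) : R := k.+1%:R / N.+2%:R.
have u01 k : 0 < u k < 1.
  by rewrite divr_gt0//= ltr_pdivrMr// mul1r ltr_nat ltnS.
pose a k := r (u k); pose b k := r (1 - u k).
have aP k : 0 < a k <= 1 / 2 /\ period (a k) = u k.
  by apply: rP; have := u01 k; lra.
have bP k : 0 < b k <= 1 / 2 /\ period (b k) = 1 - u k.
  by apply: rP; have := u01 k; lra.
have a_lt (k l : 'I_N.+1) : (k < l)%N -> a k < a l.
  move=> kl; have [[ak pk] [al pl]] := (aP k, aP l).
  have ukl : u k < u l by rewrite ltr_pM2r ?invr_gt0// ltr_nat.
  rewrite ltNge; apply/negP; rewrite le_eqVlt => /predU1P[akl|akl].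
    by move: ukl; rewrite -pk -pl akl ltxx.
  have := @period_lt R (a l) (a k); rewrite !in_itv/= pk pl => /(_ _ _ akl); lra.
(* The constant depends only on the two letters, since [v] and [w] are prescribed on [0, 1]
   alone. *)
have sep (kl : 'I_N.+1 * 'I_N.+1) : exists e, 0 < e /\
    (kl.1 != kl.2 -> forall v w, Omega Z K v -> Omega Z K w ->
     (forall t, 0 <= t <= 1 -> v t = block g (a kl.1) (b kl.1) t) ->
     (forall t, 0 <= t <= 1 -> w t = block g (a kl.2) (b kl.2) t) ->
     (e%:E <= unit_dist v w)%E).
  case: kl => k l /=.
  have [->|kl] := eqVneq k l; first by exists 1; split.
  wlog lt_kl : k l kl / (k < l)%N => [W|].
    have [lt_kl|lt_lk|/val_inj/eqP] := ltngtP k l; last by rewrite (negPf kl).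
      exact: W.
    have [|e [e0 eP]] := W l k _ lt_lk; first by rewrite eq_sym.
    exists e; split=> // _ v w Ov Ow vE wE.
    rewrite (_ : unit_dist v w = unit_dist w v).
      by apply: eP => //; rewrite eq_sym.
    by apply: eq_integral => t _; rewrite -opprB enormN.
  have [ak pk] := aP k; have [al pl] := aP l.
  have [|l0 [h0 [e [l00 lh h01 e0 eP]]]] :=
    block_separated g (b k) (b l) ak al (a_lt _ _ lt_kl).
    by rewrite pl; have := u01 l; lra.
  exists (e * (h0 - l0)); split; first by rewrite mulr_gt0// subr_gt0.
  move=> _ v w Ov Ow vE wE; apply: unit_dist_ge => // t tl.
  by rewrite vE ?wE; [exact: eP|lra|lra].
have /choice[eta etaP] := sep.
(* A minimum over finitely many pairs of letters: positive and independent of [n]. *)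
pose delta := \big[Num.min/1]_kl eta kl.
have delta0 : 0 < delta by apply: lt_bigmin => // kl _; have [] := etaP kl.
exists (delta / 2); first by rewrite divr_gt0.
move=> eps n /andP[_ eps_lt].
(* A word of length [n] is extended by the letter [ord0] to a bi-infinite sequence. *)
pose code (c : {ffun 'I_n -> 'I_N.+1}) (i : int) : 'I_N.+1 :=
  if i is Posz m then (if insub m is Some j then c j else ord0) else ord0.
pose gam c := coded g (a \o code c) (b \o code c).
have a01 c i : 0 < (a \o code c) i <= 1 / 2 by exact: (aP _).1.
have b01 c i : 0 < (b \o code c) i <= 1 / 2 by exact: (bP _).1.
have ab1 c i : period ((a \o code c) i) + period ((b \o code c) i) = 1.
  by rewrite /= (aP _).2 (bP _).2 addrC subrK.
have gamO c : Omega Z K (gam c).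
  by split; [exact: coded_global|move=> t; exact: coded_in_region].
have -> : (N.+1 ^ n)%N = #|{ffun 'I_n -> 'I_N.+1}| by rewrite card_ffun !card_ord.
apply: (@span_number_ge _ _ _ _ _ _ (fun c => exist _ (gam c) (gamO c))).
move=> x s t st.
(* Two words differ at some letter [i]; after [i] shifts the two trajectories run different blocks
   on [0, 1]. *)
have [i si] : exists i, s i != t i.
  by apply/existsP; apply: contraNT st => /existsPn H; apply/eqP/ffunP => i;
     apply/eqP; have := H i; rewrite negbK.
apply: (dyn_dist_separated (ltn_ord i) eps_lt) => /=.
have blockE c v : 0 <= v <= 1 ->
    gam c (v + i%:R) = block g (a (c i)) (b (c i)) v.
  move=> v01; rewrite /gam (@coded_block _ _ gE _ _ _ _ _ i%:Z) //; last first.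
    by rewrite intrD mulr1z -pmulrn; lra.
  by rewrite -pmulrn addrK /= valK.
have shiftO c : Omega Z K (fun t => gam c (t + i%:R)).
  by have := svalP (iter i (@F1 R Z K) (exist _ (gam c) (gamO c))); rewrite iter_F1.
apply: (@le_trans _ _ (eta (s i, t i))%:E).
  by rewrite lee_fin; exact: bigmin_le.
by have [_] := etaP (s i, t i); apply => // v v01; exact: blockE.
Qed.

End entropy.

Theorem theorem6p1 (R : realType) :
  let Z : nsvf R :=
    NSVF (fun p => (1, - 2 * p.1))
         (fun p => (- 2, - 4 * p.1 ^+ 3 + 2 * p.1)) in
  let K : set (R * R) :=
    [set p | (-1 <= p.1 <= 1) &&
             (p.1 ^+ 4 / 2 - p.1 ^+ 2 / 2 <= p.2 <= 1 - p.1 ^+ 2)] in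
  nsvf_entropy Z K = +oo%E.
Proof.
exact: (top_entropy_pinfty (@loop_field_separated R)).
Qed.
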